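(* Let $\mathcal{K}$ be a symmetric cone. Then $$\ell_{\mathcal{K}}=\mathrm{rank}\,\mathcal{K}+1 .$$
   Context: A closed convex cone $\mathcal{K}$ in a finite-dimensional real inner product space is a symmetric cone if $\mathcal{K}=\mathcal{K}^*$ (where $\mathcal{K}^*=\{x\mid\langle x,y\rangle\geq0\ \forall y\in\mathcal{K}\}$), $\mathrm{int}\,\mathcal{K}\neq\emptyset$, and for all $x,y\in\mathrm{int}\,\mathcal{K}$ there is an invertible linear map $T$ with $T(\mathcal{K})=\mathcal{K}$ and $T(x)=y$. A Euclidean Jordan algebra is a finite-dimensional real inner product space $\mathcal{E}$ with a bilinear product $\circ:\mathcal{E}\times\mathcal{E}\to\mathcal{E}$ such that, writing $x^2=x\circ x$, one has $x\circ y=y\circ x$, $x\circ(x^2\circ y)=x^2\circ(x\circ y)$ and $\langle x\circ y,z\rangle=\langle y,x\circ z\rangle$ for all $x,y,z\in\mathcal{E}$. It is known that a cone is symmetric if and only if it is the cone of squares $\mathcal{K}=\{z\circ z\mid z\in\mathcal{E}\}$ of some Euclidean Jordan algebra $(\mathcal{E},\circ)$, which may be taken to have an identity element $e$; such an algebra is fixed for $\mathcal{K}$. An element $c$ is idempotent if $c\circ c=c$; it is a primitive idempotent if moreover it is nonzero and cannot be written as $c=a+b$ with $a,b$ nonzero idempotents satisfying $a\circ b=0$. By the spectral theorem, there is an integer $r$ depending only on $\mathcal{E}$ such that every $x\in\mathcal{E}$ can be written as $x=\sum_{i=1}^r\lambda_ic_i$ where $c_1,\ldots,c_r$ are primitive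 idempotents with $c_i\circ c_j=0$ for $i\neq j$ and $c_1+\cdots+c_r=e$, and the real numbers $\lambda_1,\ldots,\lambda_r$ (the eigenvalues of $x$, with multiplicity) are uniquely determined by $x$ up to order. The rank of $x$, $\mathrm{rank}\,x$, is the number of nonzero $\lambda_i$, and $\mathrm{rank}\,\mathcal{K}=\max\{\mathrm{rank}\,x\mid x\in\mathcal{K}\}$. A face of $\mathcal{K}$ is a convex subset $\mathcal{F}\subseteq\mathcal{K}$ such that $u,v\in\mathcal{K}$ and $\alpha u+(1-\alpha)v\in\mathcal{F}$ for some $0<\alpha<1$ imply $u,v\in\mathcal{F}$. A chain of faces of $\mathcal{K}$ is a finite sequence $\mathcal{F}_1\supsetneq\cdots\supsetneq\mathcal{F}_\ell$ of nonempty faces of $\mathcal{K}$, each properly containing the next; its length is the number $\ell$ of faces. $\ell_{\mathcal{K}}$ is the length of the longest chain of faces of $\mathcal{K}$. *)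

(* Defs.v *)
From HB Require Import structures.
From mathcomp Require Import all_boot all_order all_algebra.
From mathcomp Require Import boolp classical_sets reals convex.

Set Implicit Arguments.
Unset Strict Implicit.
Unset Printing Implicit Defensive.

Import Order.TTheory GRing.Theory Num.Theory.

Local Open Scope classical_set_scope.
Local Open Scope ring_scope.

(* The largest element of a set of natural numbers; 0 if there is none. *)
Definition nat_max (A : set nat) : nat := xget 0%N (A `&` ubound A).

(* A [vectType] carries no topology, so interior and closedness are spelled   *)
(* out with the open balls of the norm of the inner product.                  *)
Section SymmetricCone.
Variables (R : realType) (E : vectType R) (dot : {dot E for idfun}).
Implicit Types K : set E.

Definition dot_ball (x : E) (eps : R) : set E :=
  [set y | dot (y - x) (y - x) < eps ^+ 2].

Definition dot_interior K : set E :=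
  [set x | exists2 eps, 0 < eps & dot_ball x eps `<=` K].

Definition dot_closed K : Prop :=
  forall x, (forall eps, 0 < eps -> dot_ball x eps `&` K !=set0) -> K x.

Definition closed_convex_cone K : Prop :=
  [/\ dot_closed K, convex_set K &
      forall (a : R) x, 0 <= a -> K x -> K (a *: x)].

Definition dual_cone K : set E := [set x | forall y, K y -> 0 <= dot x y].

Record symmetric_cone K : Prop := SymmetricCone {
  symmetric_cone_closed_convex : closed_convex_cone K;
  symmetric_cone_selfdual : K = dual_cone K;
  symmetric_cone_solid : dot_interior K !=set0;
  symmetric_cone_homogeneous : forall x y,
    dot_interior K x -> dot_interior K y ->
    exists T : {linear E -> E}, [/\ bijective T, T @` K = K & T x = y] }.

End SymmetricCone.

Section JordanAlgebra.
Variables (R : realType) (E : vectType R).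
Variables (op : {bilinear E -> E -> E}).

Record euclidean_jordan_algebra (dot : {dot E for idfun}) : Prop :=
  EuclideanJordanAlgebra {
    jordan_mulC : forall x y, op x y = op y x;
    jordan_identity : forall x y, op x (op (op x x) y) = op (op x x) (op x y);
    jordan_dotA : forall x y z, dot (op x y) z = dot y (op x z) }.

Definition jordan_unit (e : E) : Prop :=
  forall x, op e x = x /\ op x e = x.

Definition cone_of_squares : set E := [set op z z | z in setT].

Definition idempotent_elt (c : E) : Prop := op c c = c.

Definition primitive_idempotent (c : E) : Prop :=
  [/\ idempotent_elt c, c != 0 &
      ~ exists a b, [/\ idempotent_elt a /\ a != 0, idempotent_elt b /\ b != 0,
                        op a b = 0 & c = a + b]].

Record spectral_decomposition (e x : E) (r : nat)
    (lam : 'I_r -> R) (c : 'I_r -> E) : Prop := SpectralDecomposition {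
  spectral_primitive : forall i, primitive_idempotent (c i);
  spectral_orthogonal : forall i j, i != j -> op (c i) (c j) = 0;
  spectral_complete : \sum_i c i = e;
  spectral_sum : x = \sum_i lam i *: c i }.

(* The number [r] and, up to order, the eigenvalues [lam] are determined by   *)
(* [x], so the set below is a singleton.                                      *)
Definition jordan_rank (e x : E) : nat :=
  xget 0%N [set k | exists r (lam : 'I_r -> R) (c : 'I_r -> E),
    spectral_decomposition e x lam c /\ k = #|[pred i | lam i != 0]|].

Definition cone_rank (e : E) (K : set E) : nat :=
  nat_max [set jordan_rank e x | x in K].

End JordanAlgebra.

Section Faces.
Variables (R : realType) (E : vectType R).
Implicit Type K : set E.

Definition face K (F : set E) : Prop :=
  [/\ F `<=` K, convex_set F &
      forall u v (alpha : R), K u -> K v -> 0 < alpha < 1 ->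
        F (alpha *: u + (1 - alpha) *: v) -> F u /\ F v].

(* Only the values [F 0, ..., F (l - 1)] matter. *)
Definition face_chain K (l : nat) (F : nat -> set E) : Prop :=
  (forall i, (i < l)%N -> face K (F i) /\ F i !=set0) /\
  (forall i, (i.+1 < l)%N -> F i.+1 `<` F i).

Definition longest_face_chain K : nat :=
  nat_max [set l | exists F, face_chain K l F].

End Faces.

(* Main.v *)
Require Import Defs.
From mathcomp Require Import all_boot all_order all_algebra.
From mathcomp Require Import boolp classical_sets reals convex.
From mathcomp Require Import interval_inference complex ring lra.

(** A frame of an idempotent [c] is a family of pairwise orthogonal primitive
    idempotents with sum [c].  Everything rests on the fact that all frames of a
    given idempotent have the same size; call this size the rank of [c], and let
    [r] be the rank of the unit [e].

    The rank of the cone is [r]: the spectral theorem writes every element as a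
    combination of the members of a frame of [e], so that no element has rank
    above [r], and the eigenvalues of [e] itself are all equal to 1.

    A chain of [r + 1] faces comes from any frame [c_1, ..., c_r] of [e]: the
    elements of the cone orthogonal to [c_1 + ... + c_k] form a face, and
    [c_(k+1)] belongs to the [k]-th of these faces but not to the next one.

    No chain is longer.  A nonempty face [F] contains an idempotent [g] that acts
    as a unit on [F], namely one whose Peirce space is as large as possible
    ([face_idempotent]), and [F] is recovered from [g] as the set of elements of
    the cone on which [g] acts as a unit ([face_contains_peirce1]).  When the
    faces strictly increase, so do these idempotents; each difference is a nonzero
    idempotent, so that the rank grows by at least one at each step and cannot
    exceed [r].

    That frames of the same idempotent have the same size is a Steinitz exchange
    argument: if a frame of [d] has [n + 1] members and [q] is a primitive
    idempotent below [d], then [d - q] has a frame with [n] members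
    ([frame_exchange]).  It is proved by induction, by compressing [q] to the
    Peirce space of the sum of all but one members of the frame.  The induction
    needs to know that the compression [P(d)p] of a primitive idempotent [p] is a
    multiple of a primitive idempotent ([compress_prim]); here [L(x)] is the
    multiplication by [x], and [P(x) = 2 L(x)^2 - L(x^2)] is written [quad].  This
    follows from the identity [P(d) P(p) y = P(P(d)p) y], valid for [y] in the
    Peirce space of [d] ([quad_quad]): as [P(p)] has rank one, every member of a
    frame diagonalising [P(d)p] in that Peirce space is a multiple of [P(d)p], if
    its eigenvalue is nonzero.

    The spectral theorem is obtained without topology.  The powers of [x] operate
    by commuting maps, an annihilating polynomial of least degree has a real root
    because multiplication by [x] is symmetric, and the corresponding eigenvector
    is proportional to an idempotent ([eigen_idempotent]); one then splits off
    primitive idempotents one at a time. *)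

Set Implicit Arguments.
Unset Strict Implicit.
Unset Printing Implicit Defensive.

Import Order.TTheory GRing.Theory Num.Theory.

Local Open Scope classical_set_scope.
Local Open Scope ring_scope.

(** * Real polynomials *)

(** The remainder of [f] modulo this quadratic has degree at most one and
    vanishes at a non-real point, so it is zero. *)
Lemma nonreal_root_factor (R : rcfType) (f : {poly R}) (a b : R) : b != 0 ->
  root (map_poly (real_complex R) f) (a +i* b)%C ->
  exists g, f = (('X - a%:P) * ('X - a%:P) + (b ^+ 2)%:P) * g.
Proof.
move=> b0 rf; pose q : {poly R} := ('X - a%:P) * ('X - a%:P) + (b ^+ 2)%:P.
have szq : size q = 3%N.
  rewrite size_polyDl ?size_mul ?polyXsubC_eq0 ?size_XsubC //.
  exact: leq_ltn_trans (size_polyC_leq1 _) _.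
exists (f %/ q).
suff r0 : f %% q = 0 by rewrite {1}(divp_eq f q) r0 addr0 mulrC.
have szr : (size (f %% q)%R <= 2)%N.
  by rewrite -ltnS -szq ltn_modp -size_poly_eq0 szq.
set r : {poly R} := f %% q in szr *.
have rE : r = (r`_0)%:P + r`_1 *: 'X.
  apply/polyP => -[|[|i]]; rewrite coefD coefC coefZ coefX /= ?mulr0 ?addr0 //.
    by rewrite mulr1 add0r.
  by rewrite nth_default // (leq_trans szr).
have : (map_poly (real_complex R) r).[(a +i* b)%C] = 0.
  have := rf; rewrite /root {1}(divp_eq f q) -/r rmorphD rmorphM hornerD hornerM.
  suff -> : (map_poly (real_complex R) q).[(a +i* b)%C] = 0.
    by rewrite mulr0 add0r => /eqP.
  rewrite /q rmorphD rmorphM /= map_polyXsubC map_polyC /= !hornerE /=.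
  by apply/eqP; rewrite eq_complex /=; apply/andP; split; apply/eqP; ring.
rewrite rE rmorphD /= map_polyC map_polyZ /= map_polyX !hornerE /= => /eqP.
rewrite eq_complex /= => /andP[/eqP e1 /eqP e2].
have r1 : r`_1 = 0.
  move: e2; rewrite mul0r addr0 add0r => /eqP.
  by rewrite mulf_eq0 (negPf b0) orbF => /eqP.
move: e1; rewrite r1 !mul0r subr0 addr0 => r0'.
by rewrite r0' scale0r polyC0 addr0.
Qed.

Section EuclideanJordan.
Variables (R : realType) (E : vectType R) (dot : {dot E for idfun}).
Variables (op : {bilinear E -> E -> E}).
Hypothesis eja : euclidean_jordan_algebra op dot.

Local Notation "x ** y" := (op x y) (at level 40, left associativity).
Local Notation idem := (idempotent_elt op).
Local Notation prim := (primitive_idempotent op).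

(** * Bilinearity and the polarised Jordan identity *)

Lemma opC x y : x ** y = y ** x. Proof. exact: (jordan_mulC eja). Qed.
Lemma opDl x y z : (x + y) ** z = x ** z + y ** z. Proof. exact: linearDl. Qed.
Lemma opDr x y z : z ** (x + y) = z ** x + z ** y. Proof. exact: linearDr. Qed.
Lemma opNl x z : (- x) ** z = - (x ** z). Proof. exact: linearNl. Qed.
Lemma opNr x z : z ** (- x) = - (z ** x). Proof. exact: linearNr. Qed.
Lemma opZl a x z : (a *: x) ** z = a *: (x ** z).
Proof. exact: linearZl_LR. Qed.
Lemma opZr a x z : z ** (a *: x) = a *: (z ** x).
Proof. exact: linearZr_LR. Qed.
Lemma op0l z : 0 ** z = 0. Proof. exact: linear0l. Qed.
Lemma op0r z : z ** 0 = 0. Proof. exact: linear0r. Qed.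
Definition opE := (opDl, opDr, opNl, opNr, opZl, opZr, op0l, op0r).

Lemma dotC x y : dot x y = dot y x.
Proof. by have := hermC dot x y; rewrite /= expr0 mul1r. Qed.
Lemma dotDl x y z : dot (x + y) z = dot x z + dot y z. Proof. exact: linearDl. Qed.
Lemma dotNl x z : dot (- x) z = - dot x z. Proof. exact: linearNl. Qed.
Lemma dotZl a x z : dot (a *: x) z = a * dot x z.
Proof. exact: linearZl_LR. Qed.
Lemma dot0l z : dot 0 z = 0. Proof. exact: linear0l. Qed.
Lemma dotDr x y z : dot z (x + y) = dot z x + dot z y.
Proof. by rewrite ![dot z _]dotC dotDl. Qed.
Lemma dotNr x z : dot z (- x) = - dot z x.
Proof. by rewrite ![dot z _]dotC dotNl. Qed.
Lemma dotZr a x z : dot z (a *: x) = a * dot z x.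
Proof. by rewrite ![dot z _]dotC dotZl. Qed.
Lemma dot0r z : dot z 0 = 0.
Proof. by rewrite ![dot z _]dotC dot0l. Qed.
Definition dotE := (dotDl, dotDr, dotNl, dotNr, dotZl, dotZr, dot0l, dot0r).

Lemma dotA x y z : dot (x ** y) z = dot y (x ** z).
Proof. exact: (jordan_dotA eja). Qed.

Lemma dot_gt0 x : x != 0 -> 0 < dot x x. Proof. exact: neq0_dnorm_gt0. Qed.
Lemma dot_ge0 x : 0 <= dot x x.
Proof. by have [->|/dot_gt0/ltW] := eqVneq x 0; rewrite // dot0l. Qed.
Lemma dot_eq0 x : dot x x = 0 -> x = 0.
Proof. by move=> xx0; apply: contra_eq xx0 => /dot_gt0; rewrite lt_def => /andP[]. Qed.

(** Vector identities are proved by testing against an arbitrary vector, which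
    turns them into linear identities between scalars. *)
Lemma dot_ext x y : (forall v, dot x v = dot y v) -> x = y.
Proof.
move=> xy; apply/eqP; rewrite -subr_eq0; apply/eqP/dot_eq0.
by rewrite dotDl dotNl xy subrr.
Qed.

(** The part of the Jordan identity at [x + z] that is of degree one in [z],
    extracted from its values at [x + z], [x - z] and [z]. *)
Lemma jordan_polar2 x z y :
  2 *: (x ** ((x ** z) ** y)) + z ** ((x ** x) ** y) =
  2 *: ((x ** z) ** (x ** y)) + (x ** x) ** (z ** y).
Proof.
have J u := jordan_identity eja u y.
have := J (x + z); have := J (x - z); have := J z.
rewrite !opE (opC z x) => Jz Jm Jp; apply: dot_ext => v.
move: (congr1 (dot^~ v) Jz) (congr1 (dot^~ v) Jm) (congr1 (dot^~ v) Jp).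
rewrite !dotE; lra.
Qed.

(** The full polarisation of the Jordan identity.  Read as an identity between
    operators on any one of its four arguments, it is the source of all the
    commutation rules below. *)
Lemma jordan_polar3 x z w y :
  x ** ((z ** w) ** y) + z ** ((x ** w) ** y) + w ** ((x ** z) ** y) =
  (z ** w) ** (x ** y) + (x ** w) ** (z ** y) + (x ** z) ** (w ** y).
Proof.
have Jxw := jordan_polar2 (x + w) z y.
have Jx := jordan_polar2 x z y; have Jw := jordan_polar2 w z y.
move: Jx Jw Jxw; rewrite !opE (opC w x) (opC z w) => Jx Jw Jxw.
apply: dot_ext => v.
move: (congr1 (dot^~ v) Jx) (congr1 (dot^~ v) Jw) (congr1 (dot^~ v) Jxw).
rewrite !dotE; lra.
Qed.

(** * Peirce decomposition *)

(** For an idempotent [c], [P(c) = 2 L(c)^2 - L(c)] is the orthogonal projection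
    onto the Peirce space of [c] for the eigenvalue 1. *)
Definition quad x v := 2 *: (x ** (x ** v)) - (x ** x) ** v.

Section Peirce.
Variables (c : E) (idc : idem c).

(** In [jordan_polar3] with two arguments equal to [c], only the commutator of
    [L(c)] and [L(y)] survives. *)
Lemma peirce1_comm y v : c ** y = y -> c ** (y ** v) = y ** (c ** v).
Proof.
move=> cy; have := jordan_polar3 c c y v; rewrite cy idc => J.
apply: dot_ext => u; move: (congr1 (dot^~ u) J); rewrite !dotE; lra.
Qed.

Lemma peirce0_comm y v : c ** y = 0 -> c ** (y ** v) = y ** (c ** v).
Proof.
move=> cy; have := jordan_polar3 c c y v.
by rewrite cy idc !opE !add0r.
Qed.

(** [L(y)] and [L(z)] both commute with [L(c)], so the product of [y] and [z] lies
    in the eigenspace of [c] for 0 as well as in the one for 1. *)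
Lemma peirce10 y z : c ** y = y -> c ** z = 0 -> y ** z = 0.
Proof.
move=> cy cz; have := peirce1_comm z cy; have := peirce0_comm y cz.
by rewrite cy cz op0r (opC y) => ->.
Qed.

Lemma peirce11 y z : c ** y = y -> c ** z = z -> c ** (y ** z) = y ** z.
Proof. by move=> cy cz; rewrite peirce1_comm ?cz. Qed.

(** [L(c)] is annihilated by [t(2t - 1)(t - 1)], hence diagonalisable with
    eigenvalues 0, 1/2 and 1. *)
Lemma peirce_cubic v :
  2 *: (c ** (c ** (c ** v))) = 3 *: (c ** (c ** v)) - c ** v.
Proof.
have := jordan_polar3 c v c c.
rewrite !(opC v) !idc (opC (_ ** v)) => J.
apply: dot_ext => u; move: (congr1 (dot^~ u) J); rewrite !dotE.
lra.
Qed.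

Lemma quad_idem1 v : c ** quad c v = quad c v.
Proof.
rewrite /quad idc !opE peirce_cubic; apply: dot_ext => u; rewrite !dotE; lra.
Qed.

Lemma quad_id v : c ** v = v -> quad c v = v.
Proof.
by move=> cv; rewrite /quad idc !cv -{2}(scale1r v) -scalerBl addrK scale1r.
Qed.

Lemma dot_quad v w : dot (quad c v) w = dot v (quad c w).
Proof. by rewrite /quad idc !dotE !dotA. Qed.

Lemma peirce_dec v : exists vh v0,
  [/\ v = quad c v + vh + v0, c ** vh = 2^-1 *: vh & c ** v0 = 0].
Proof.
exists (4 *: (c ** v - c ** (c ** v))), (v - 3 *: (c ** v) + 2 *: (c ** (c ** v))).
have C := peirce_cubic v.
split; apply: dot_ext => u; move: (congr1 (dot^~ u) C);
  rewrite /quad ?idc ?opE ?dotE; lra.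
Qed.

Lemma eigen_orth a b u v : a != b ->
  c ** u = a *: u -> c ** v = b *: v -> dot u v = 0.
Proof.
move=> ab cu cv; have := dotA c u v; rewrite cu cv !dotE => /eqP.
by rewrite -subr_eq0 -mulrBl mulf_eq0 subr_eq0 (negPf ab) => /eqP.
Qed.

(** With [z = z_1 + z_h + z_0] the Peirce decomposition,
    [dot (z^2) c = dot z (L(c)z) = |z_1|^2 + |z_h|^2 / 2], so that orthogonality
    forces [z = z_0], and the 0-eigenspace of [c] is a subalgebra. *)
Lemma sqr_orth_idem z : dot (z ** z) c = 0 -> c ** (z ** z) = 0.
Proof.
have [zh [z0 [+ ch c0]]] := peirce_dec z; have := quad_idem1 z.
move: (quad c z) => z1 c1 ze.
rewrite dotA (opC z) => z_0; suff cz : c ** z = 0.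
  by rewrite peirce0_comm // cz op0r.
have c0' : c ** z0 = 0 *: z0 by rewrite scale0r.
have c1' : c ** z1 = 1 *: z1 by rewrite scale1r.
have ne1h : 1 != 2^-1 :> R by apply/eqP; lra.
have neh0 : 2^-1 != 0 :> R by apply/eqP; lra.
have o1h := eigen_orth ne1h c1' ch; have o10 := eigen_orth (oner_neq0 _) c1' c0'.
have oh0 := eigen_orth neh0 ch c0'.
have g1 := dot_ge0 z1; have gh := dot_ge0 zh.
move: z_0; rewrite ze !opE c1 ch c0 !dotE (dotC zh z1) o1h !(dotC z0) o10 oh0.
move=> s; have z1_0 : z1 = 0 by apply: dot_eq0; lra.
have zh_0 : zh = 0 by apply: dot_eq0; lra.
by rewrite z1_0 zh_0 scaler0 !addr0.
Qed.

(** The elements [y] of the Peirce 1-space of [c] act on its 1/2-space through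
    [2 L(y)], and this is a morphism of Jordan algebras. *)
Lemma peirce1_half y w h : c ** y = y -> c ** w = w -> c ** h = 2^-1 *: h ->
  (y ** w) ** h = y ** (w ** h) + w ** (y ** h).
Proof.
move=> cy cw ch; have := jordan_polar3 y c h w.
rewrite ch (opC y c) cy cw !opE (opC (y ** h)) (peirce1_comm _ cw).
rewrite (peirce1_comm _ cy) ch !opE !(opC h) => J.
apply: dot_ext => u; move: (congr1 (dot^~ u) J); rewrite !dotE.
lra.
Qed.

End Peirce.

(** * Polynomials in one element *)

Lemma op_sumr (I : Type) (r : seq I) (P : pred I) (F : I -> E) z :
  z ** (\sum_(i <- r | P i) F i) = \sum_(i <- r | P i) z ** F i.
Proof. exact: (big_morph (op z) (fun u v => opDr u v z) (op0r z)). Qed.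

Lemma op_suml (I : Type) (r : seq I) (P : pred I) (F : I -> E) z :
  (\sum_(i <- r | P i) F i) ** z = \sum_(i <- r | P i) F i ** z.
Proof. by rewrite opC op_sumr; apply: eq_bigr => i _; rewrite opC. Qed.

Lemma dot_suml (I : Type) (r : seq I) (P : pred I) (F : I -> E) z :
  dot (\sum_(i <- r | P i) F i) z = \sum_(i <- r | P i) dot (F i) z.
Proof.
exact: (big_morph (fun u => dot u z) (fun u v => dotDl u v z) (dot0l z)).
Qed.

(** Everything takes place in the Peirce 1-space of an idempotent [c], which
    plays the role of the unit; for [c = e] this is the whole algebra. *)
Section Powers.
Variables (c x : E) (idc : idem c) (cx : c ** x = x).

Definition power n := iter n (op x) c.

Lemma power_unit n : c ** power n = power n.
Proof. by elim: n => // n IHn; apply: peirce11. Qed.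

Lemma powerSS n : power n.+2 = (x ** x) ** power n.
Proof.
elim: n => [|n IHn]; last first.
  by rewrite /= in IHn *; rewrite IHn (jordan_identity eja).
by rewrite /= (opC x c) cx opC peirce11.
Qed.

(** By [jordan_polar2] the operator [L(x^(n+2))] is a polynomial expression in
    [L(x)], [L(x^2)], [L(x^n)] and [L(x^(n+1))], all of which commute with
    [L(x)]. *)
Lemma power_comm n v : x ** (power n ** v) = power n ** (x ** v).
Proof.
elim: n {-2}n (leqnn n) v => [|m IHm] [|[|n]] // nm v; try exact/esym/peirce1_comm.
  by rewrite /= (opC x c) cx.
have P u := jordan_polar2 x u (power n).
have {}P u : power n.+2 ** u = 2 *: (power n.+1 ** (x ** u))
    + (x ** x) ** (power n ** u) - 2 *: (x ** (power n ** (x ** u))).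
  rewrite powerSS /= -[x ** power n]/(power n.+1).
  have := P u; rewrite (opC u (_ ** _)) (opC u (power n)).
  rewrite (opC (x ** u) (power n)) (opC (x ** u) (x ** power n)) => Pu.
  apply: dot_ext => t; move: (congr1 (dot^~ t) Pu); rewrite !dotE; lra.
rewrite !P !opE (IHm n.+1) // (jordan_identity eja) !(IHm n) //.
all: exact: leq_trans (leqnSn _) nm.
Qed.

Definition peval (f : {poly R}) := \sum_(i < size f) f`_i *: power i.

Lemma peval_wide n (f : {poly R}) : (size f <= n)%N ->
  peval f = \sum_(i < n) f`_i *: power i.
Proof.
move=> fn; rewrite /peval (big_ord_widen n (fun i => f`_i *: power i)) //.
rewrite big_mkcond; apply: eq_bigr => i _; case: ltnP => // fi.
by rewrite nth_default // scale0r.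
Qed.

Lemma pevalD (f g : {poly R}) : peval (f + g) = peval f + peval g.
Proof.
have fgn : (size (f + g)%R <= maxn (size f) (size g))%N by exact: size_polyD.
rewrite (peval_wide fgn) (peval_wide (leq_maxl (size f) (size g))).
rewrite (peval_wide (leq_maxr (size f) (size g))) -big_split /=.
by apply: eq_bigr => i _; rewrite coefD scalerDl.
Qed.

Lemma pevalZ a f : peval (a *: f) = a *: peval f.
Proof.
rewrite (peval_wide (size_scale_leq a f)) /peval scaler_sumr.
by apply: eq_bigr => i _; rewrite coefZ scalerA.
Qed.

Lemma pevalMX f : peval ('X * f) = x ** peval f.
Proof.
have fn : (size ('X * f)%R <= (size f).+1)%N.
  by rewrite (leq_trans (size_polyMleq _ _)) // size_polyX.
rewrite (peval_wide fn) big_ord_recl coefXM /= scale0r add0r op_sumr.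
by apply: eq_bigr => i _; rewrite coefXM /= opZr.
Qed.

Lemma peval_lin a f : peval (('X - a%:P) * f) = x ** peval f - a *: peval f.
Proof.
by rewrite mulrBl pevalD pevalMX mul_polyC -!scaleNr pevalZ.
Qed.

Lemma peval_unit f : c ** peval f = peval f.
Proof.
by rewrite op_sumr; apply: eq_bigr => i _; rewrite opZr power_unit.
Qed.

Lemma peval_comm f v : x ** (peval f ** v) = peval f ** (x ** v).
Proof.
rewrite !op_suml op_sumr; apply: eq_bigr => i _.
by rewrite !opE power_comm.
Qed.

Lemma peval_eigen f g l : x ** peval f = l *: peval f ->
  peval g ** peval f = g.[l] *: peval f.
Proof.
move=> xf; have pf n : power n ** peval f = l ^+ n *: peval f.
  elim: n => [|n IHn]; first by rewrite scale1r peval_unit.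
  rewrite -[power n.+1]/(x ** power n) (opC (x ** _)) -peval_comm.
  by rewrite (opC _ (power n)) IHn opZr xf scalerA exprSr.
rewrite op_suml horner_coef scaler_suml; apply: eq_bigr => i _.
by rewrite opZl pf scalerA.
Qed.

(** The powers of [x] are linearly dependent. *)
Lemma peval_annihilator : exists f, (f != 0) && (peval f == 0).
Proof.
set n := (\dim {: E}).+1; pose X := [tuple power i | i < n].
have nfr : ~ free X.
  have := dimvS (subvf (<<X>>%VS)).
  by rewrite /free => le /eqP dX; move: le; rewrite dX size_tuple ltnn.
have [k kX [i /eqP ki]] : exists2 k : 'I_n -> R,
    \sum_(i < n) k i *: X`_i = 0 & exists i, k i <> 0.
  have [//|nk] := pselect (exists2 k : 'I_n -> R,
    \sum_(i < n) k i *: X`_i = 0 & exists i, k i <> 0).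
  case: nfr; apply/freeP => k kX i; have [//|/eqP ki] := eqVneq (k i) 0.
  by case: nk; exists k => //; exists i.
(* [inord] is available because [n] is a successor. *)
pose f := \poly_(j < n) k (inord j).
have fk (j : 'I_n) : f`_j = k j by rewrite coef_poly ltn_ord inord_val.
exists f; apply/andP; split.
  by apply: contra_neq ki => f0; rewrite -fk f0 coef0.
rewrite (peval_wide (size_poly _ _)) -[X in _ == X]kX.
apply/eqP; apply: eq_bigr => j _.
by rewrite fk (nth_map j) ?size_tuple // nth_ord_enum.
Qed.

(** Take a nonzero polynomial [f] of least degree with [f(x) = 0], and a complex
    root of it.  If the root [a] is real, [f = (X - a)g] and [u = g(x)] is nonzero
    with [x u = a u], so [u^2 = g(a) u] and [u / g(a)] is an idempotent.  If
    the root is [a + bi] with [b] nonzero, [f = ((X - a)^2 + b^2)g] and, for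
    [u = g(x)] and [w = x u - a u], symmetry of [L(x)] gives
    [|w|^2 + b^2 |u|^2 = 0], hence [u = 0], against minimality. *)
Lemma eigen_idempotent : c != 0 -> exists l c',
  [/\ idem c', c' != 0, c ** c' = c' & x ** c' = l *: c'].
Proof.
move=> c0; pose P n := `[< exists f, [/\ f != 0, peval f = 0 & size f = n] >].
have exP : exists n, P n.
  have [f /andP[f0 /eqP pf]] := peval_annihilator.
  by exists (size f); apply/asboolP; exists f.
case: (ex_minnP exP) => n /asboolP[f [f0 pf <-]] minf {n}.
have nzg q g : f = q * g -> (1 < size q)%N -> peval g != 0.
  move=> fqg q1; move: (f0).
  rewrite {1}fqg mulf_eq0 negb_or => /andP[q0 g0].
  apply/eqP => pg; have : (size f <= size g)%N.
    by apply: minf; apply/asboolP; exists g.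
  rewrite fqg size_mul //; move: q1 (size_poly_gt0 g); rewrite g0.
  case: (size q) => [|[|k]] // _ _; rewrite addSn /= addSn ltnNge leq_addl //.
have sf : size (map_poly (real_complex R) f) != 1%N.
  rewrite size_map_poly; apply/eqP => /eqP/size_poly1P[a a0 fa].
  move: pf; rewrite fa /peval size_polyC a0 big_ord1 coefC /= => /eqP.
  by rewrite scaler_eq0 (negPf a0) (negPf c0).
have [[a b] rz] := closed_rootP _ sf.
have [b0|b0] := eqVneq b 0.
  have /factor_theorem[g fg] : root f a.
    by move: rz; rewrite b0 -[(a +i* 0)%C]/(real_complex R a) fmorph_root.
  rewrite mulrC in fg; have u0 := nzg _ _ fg; rewrite size_XsubC in u0.
  have {}u0 := u0 isT.
  have xu : x ** peval g = a *: peval g.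
    by apply/eqP; rewrite -subr_eq0 -peval_lin -fg pf.
  have uu := peval_eigen g xu.
  have ga : g.[a] != 0.
    apply: contra_neq u0 => ga; apply: dot_eq0.
    by rewrite -{1}(peval_unit g) (opC c) dotA uu ga scale0r dot0r.
  exists a, (g.[a]^-1 *: peval g); split.
  - by rewrite /idempotent_elt !opE uu !scalerA -mulrA mulVf // mulr1.
  - by rewrite scaler_eq0 invr_eq0 (negPf ga).
  - by rewrite opZr peval_unit.
  - by rewrite opZr xu !scalerA mulrC.
have [g fg] := nonreal_root_factor b0 rz; have := nzg _ _ fg.
rewrite size_polyDl ?size_mul ?polyXsubC_eq0 ?size_XsubC //; last first.
  exact: leq_ltn_trans (size_polyC_leq1 _) _.
move=> /(_ isT) u0; move: pf; rewrite fg mulrDl pevalD -mulrA !peval_lin.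
rewrite mul_polyC pevalZ; set u := peval g in u0 *.
move wE : (x ** u - a *: u) => w.
have ww : dot w w = dot (x ** w) u - a * dot w u.
  by rewrite -{2}wE dotDr dotNr dotZr dotA.
move=> /(congr1 (dot^~ u)).
have -> : dot (x ** w - a *: w + b ^+ 2 *: u) u = dot w w + b ^+ 2 * dot u u.
  by rewrite ww dotDl dotDl dotNl !dotZl.
have bu : 0 <= b ^+ 2 * dot u u by rewrite mulr_ge0 ?sqr_ge0 ?dot_ge0.
rewrite dot0l => /eqP; rewrite paddr_eq0 ?dot_ge0 //.
rewrite mulf_eq0 sqrf_eq0 (negPf b0) /= => /andP[_ /eqP/dot_eq0 u00].
by rewrite u00 eqxx in u0.
Qed.

End Powers.

(** * Primitive idempotents and the spectral theorem *)

Lemma idemD a b : idem a -> idem b -> a ** b = 0 -> idem (a + b).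
Proof.
by move=> ida idb ab; rewrite /idempotent_elt !opE (opC b) ab ida idb addr0 add0r.
Qed.

Lemma idemB c p : idem c -> idem p -> c ** p = p ->
  idem (c - p) /\ (c - p) ** p = 0.
Proof.
move=> idc idp cp; split; last by rewrite !opE cp idp subrr.
by rewrite /idempotent_elt !opE (opC p) cp idc idp subrr addr0.
Qed.

(** [b ** a = a] says that [a] is below [b] in the order of idempotents: [b - a] is
    then an idempotent orthogonal to [a], so it kills what [a] fixes. *)
Lemma idem_le_trans a b v : idem a -> idem b -> b ** a = a -> a ** v = v ->
  b ** v = v.
Proof.
move=> ida idb ba av; have [_ ab0] := idemB idb ida ba.
have : v ** (b - a) = 0 by apply: (peirce10 ida av); rewrite opC.
by rewrite opC !opE av => /eqP; rewrite subr_eq0 => /eqP.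
Qed.

Lemma idem_orth_le a b v : idem b -> b ** a = 0 -> b ** v = v -> a ** v = 0.
Proof. by move=> idb ba bv; rewrite opC (peirce10 idb). Qed.

(** Its dimension is the measure for the inductions along the order of
    idempotents. *)
Definition peirce1 (c : E) : {vspace E} := lker (linfun (op c) - \1)%VF.

Lemma mem_peirce1 c v : (v \in peirce1 c) = (c ** v == v).
Proof. by rewrite memv_ker add_lfunE opp_lfunE lfunE id_lfunE subr_eq0. Qed.

Lemma dim_peirce1_lt p c : idem p -> idem c -> c ** p = p -> p != c ->
  (\dim (peirce1 p) < \dim (peirce1 c))%N.
Proof.
move=> idp idc cp pc; have [idcp cp0] := idemB idc idp cp.
have sub : (peirce1 p <= peirce1 c)%VS.
  apply/subvP => v; rewrite !mem_peirce1 => /eqP pv.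
  by apply/eqP; apply: idem_le_trans pv.
rewrite ltn_neqAle dimvS // andbT; apply: contra_neq pc => dimE.
have /eqP PE : peirce1 p == peirce1 c by rewrite eqEdim sub dimE leqnn.
have : c \in peirce1 p by rewrite PE mem_peirce1 idc.
by rewrite mem_peirce1 opC cp => /eqP.
Qed.

Lemma prim_below c : idem c -> c != 0 -> exists2 p, prim p & c ** p = p.
Proof.
elim: (\dim (peirce1 c)).+1 {-2}c (ltnSn (\dim (peirce1 c))) => // n IHn {}c cn idc c0.
have [pc|npc] := pselect (prim c); first by exists c.
have [a [b [[ida a0] [idb b0] ab cab]]] : exists a b,
    [/\ idem a /\ a != 0, idem b /\ b != 0, a ** b = 0 & c = a + b].
  by apply: contrapT => nab; apply: npc; split.
have ca : c ** a = a by rewrite cab opDl ida (opC b) ab addr0.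
have ac : a != c.
  by apply: contra_neq b0 => ac; apply: (addrI a); rewrite -cab addr0.
have [p pp ap] := IHn a (leq_trans (dim_peirce1_lt ida idc ca ac) cn) ida a0.
by exists p => //; apply: idem_le_trans ap.
Qed.

Lemma prim_le_eq a q : prim a -> idem q -> q != 0 -> a ** q = q -> q = a.
Proof.
move=> [ida a0 nab] idq q0 aq; have [idaq aq0] := idemB ida idq aq.
have [->//|qa] := eqVneq q a; case: nab; exists q, (a - q); split => //.
- by split; rewrite // subr_eq0 eq_sym.
- by rewrite opC.
- by rewrite addrC subrK.
Qed.

(** An eigen-idempotent of [x] below [p] can only be [p] itself. *)
Lemma prim_line p x : prim p -> p ** x = x -> exists l, x = l *: p.
Proof.
move=> pp px; have [idp p0 _] := pp.
have [l [q [idq q0 pq xq]]] := eigen_idempotent idp px p0.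
exists l; have qp := prim_le_eq pp idq q0 pq.
by rewrite -px opC -{1}qp xq qp.
Qed.

Lemma eigen_prim c x : idem c -> c ** x = x -> c != 0 ->
  exists l p, [/\ prim p, c ** p = p & x ** p = l *: p].
Proof.
move=> idc cx c0; have [l [q [idq q0 cq xq]]] := eigen_idempotent idc cx c0.
have [p pp qp] := prim_below idq q0; exists l, p; split => //.
  exact: idem_le_trans qp.
have : q ** (x - l *: q) = 0 by rewrite !opE idq opC xq subrr.
move/(peirce10 idq qp); rewrite !opE (opC p q) qp opC => /eqP.
by rewrite subr_eq0 => /eqP.
Qed.

(** Split off a primitive idempotent [p] with [x p = l p] and apply induction to
    [x - l p] in the Peirce space of [c - p]. *)
Lemma spectral_theorem c x : idem c -> c ** x = x ->
  exists r (lam : 'I_r -> R) (cs : 'I_r -> E),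
    spectral_decomposition op c x lam cs.
Proof.
elim: (\dim (peirce1 c)).+1 {-2}c x (ltnSn (\dim (peirce1 c))) => //.
move=> n IHn {}c x cn idc cx.
have [c0|c0] := eqVneq c 0.
  exists 0%N, (fun=> 0), (fun=> 0); split; try by case.
    by rewrite big_ord0.
  by rewrite big_ord0 -cx c0 op0l.
have [l [p [pp cp xp]]] := eigen_prim idc cx c0; have [idp p0 _] := pp.
have [idcp cp0] := idemB idc idp cp.
have cpc : c ** (c - p) = c - p by rewrite !opE idc cp.
have ltn : (\dim (peirce1 (c - p)) < n)%N.
  apply: leq_trans (dim_peirce1_lt idcp idc cpc _) cn.
  by rewrite -subr_eq0 addrAC subrr add0r oppr_eq0.
have cpx : (c - p) ** (x - l *: p) = x - l *: p.
  by rewrite opDr opNr opZr cp0 scaler0 subr0 opDl opNl cx (opC p x) xp.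
have [r [lam [cs [csp cso css csx]]]] := IHn _ _ ltn idcp cpx.
pose ext T (a : T) (f : 'I_r -> T) (i : 'I_r.+1) := oapp f a (unlift ord0 i).
have ext0 T a (f : 'I_r -> T) : ext T a f ord0 = a by rewrite /ext unlift_none.
have extS T a (f : 'I_r -> T) i : ext T a f (lift ord0 i) = f i by rewrite /ext liftK.
have csp0 i : p ** cs i = 0.
  apply: (idem_orth_le idcp cp0); rewrite -css op_suml (bigD1 i) //= big1 ?addr0.
    by case: (csp i).
  by move=> j /cso.
exists r.+1, (ext _ l lam), (ext _ p cs); split.
- by move=> i; case: (unliftP ord0 i) => [j|] ->; rewrite ?extS ?ext0.
- move=> i j; case: (unliftP ord0 i) => [i'|] ->; case: (unliftP ord0 j) => [j'|] ->;
    rewrite ?extS ?ext0 ?eqxx // => ij; last by rewrite opC.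
  by apply: cso; apply: contra_neq ij => ->.
- rewrite big_ord_recl ext0; under eq_bigr do rewrite extS.
  by rewrite css addrC subrK.
- rewrite big_ord_recl !ext0; under eq_bigr do rewrite !extS.
  by rewrite -csx addrC subrK.
Qed.

Section Decomposition.
Variables (c x : E) (r : nat) (lam : 'I_r -> R) (cs : 'I_r -> E).
Hypothesis spec : spectral_decomposition op c x lam cs.

Lemma spectral_idem i : idem (cs i).
Proof. by case: (spectral_primitive spec i). Qed.

Lemma spectral_neq0 i : cs i != 0.
Proof. by case: (spectral_primitive spec i). Qed.

Lemma spectral_lincomb_op (mu : 'I_r -> R) i :
  (\sum_j mu j *: cs j) ** cs i = mu i *: cs i.
Proof.
rewrite op_suml (bigD1 i) //= opZl spectral_idem big1 ?addr0 // => j ji.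
by rewrite opZl (spectral_orthogonal spec) // scaler0.
Qed.

Lemma spectral_op i : x ** cs i = lam i *: cs i.
Proof. by rewrite {1}(spectral_sum spec) spectral_lincomb_op. Qed.

Lemma spectral_le i : c ** cs i = cs i.
Proof.
have := spectral_lincomb_op (fun=> 1) i; under eq_bigr do rewrite scale1r.
by rewrite (spectral_complete spec) scale1r.
Qed.

Lemma spectral_sqr_op i : (x ** x) ** cs i = lam i ^+ 2 *: cs i.
Proof.
have -> : x ** x = \sum_j lam j ^+ 2 *: cs j.
  rewrite {2}(spectral_sum spec) op_sumr; apply: eq_bigr => j _.
  by rewrite opZr spectral_op scalerA.
exact: spectral_lincomb_op.
Qed.

End Decomposition.

(** * Compression of a primitive idempotent *)

(** Both sides lie in the Peirce 1-space of [d], so it suffices to test against a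
    vector [w] of that space.  Writing [p = q + h + z] for the Peirce decomposition
    of [p], the terms in [z] vanish, and the terms in [h] cancel because
    [dot h (h (y w)) = 2 dot (h y) (h w)] by [peirce1_half]. *)
Lemma quad_quad d p y : idem d -> d ** y = y ->
  quad d (quad p y) = quad (quad d p) y.
Proof.
move=> idd dy; have d1 := quad_idem1 idd p.
have t1 : d ** (quad d (quad p y) - quad (quad d p) y) =
    quad d (quad p y) - quad (quad d p) y.
  rewrite opDr opNr quad_idem1 //; congr (_ - _); move: d1.
  move: (quad d p) => q d1.
  have qy := peirce11 idd d1 dy; have qq := peirce11 idd d1 d1.
  by rewrite /quad opDr opNr opZr (peirce11 idd d1 qy) (peirce11 idd qq dy).
suff test w : d ** w = w ->
    dot (quad d (quad p y)) w = dot (quad (quad d p) y) w.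
  move/eqP: (test _ t1); rewrite -subr_eq0 -dotNl -dotDl => /eqP/dot_eq0/eqP.
  by rewrite subr_eq0 => /eqP.
move=> dw; rewrite dot_quad // (quad_id idd dw).
have quadE u : dot (quad u y) w = 2 * dot (u ** y) (u ** w) - dot u (u ** (y ** w)).
  by rewrite /quad dotDl dotNl dotZl (dotA u) (opC (u ** u)) (dotA y) (dotA u u).
rewrite !quadE; have [h [z [+ dh dz]]] := peirce_dec idd p.
move: (quad d p) d1 => q d1 ->.
have dyw : d ** (y ** w) = y ** w by apply: peirce11.
have zy : z ** y = 0 by rewrite opC (peirce10 idd).
have zw : z ** w = 0 by rewrite opC (peirce10 idd).
have zyw : z ** (y ** w) = 0 by rewrite opC (peirce10 idd).
have half v : d ** v = v -> d ** (h ** v) = 2^-1 *: (h ** v).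
  by move=> dv; rewrite (opC h) (peirce1_comm idd h dv) dh opZr.
have ne1h : 1 != 2^-1 :> R by apply/eqP; lra.
have neh1 : 2^-1 != 1 :> R by apply/eqP; lra.
have neh0 : 0 != 2^-1 :> R by apply/eqP; lra.
have ne01 : 0 != 1 :> R by rewrite eq_sym oner_neq0.
have one v : d ** v = v -> d ** v = 1 *: v by rewrite scale1r.
have zz : d ** z = 0 *: z by rewrite scale0r.
have qv v : d ** v = v -> d ** (q ** v) = 1 *: (q ** v).
  by move=> dv; rewrite scale1r peirce11.
rewrite !opDl zy zw zyw !addr0 !dotDl !dotDr.
rewrite (eigen_orth ne1h (qv _ dy) (half _ dw)).
rewrite (eigen_orth neh1 (half _ dy) (qv _ dw)).
rewrite (eigen_orth ne1h (one _ d1) (half _ dyw)).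
rewrite (eigen_orth neh1 dh (qv _ dyw)).
rewrite (eigen_orth ne01 zz (qv _ dyw)).
rewrite (eigen_orth neh0 zz (half _ dyw)).
rewrite [h ** (y ** w)]opC (peirce1_half idd dy dw dh) dotDr.
rewrite -(dotA y h) -(dotA w h) !(opC h) (dotC (w ** h)). lra.
Qed.

(** [P(p)] projects onto the Peirce 1-space of [p], which is a line. *)
Lemma quad_prim p y : prim p -> exists l, quad p y = l *: p.
Proof.
by move=> pp; have [idp _ _] := pp; apply: prim_line (quad_idem1 idp y).
Qed.

Lemma quadZ x a v : quad x (a *: v) = a *: quad x v.
Proof. by rewrite /quad !opZr scalerBr !scalerA mulrC. Qed.

(** Let [c_i] belong to a spectral decomposition of [P(d)p] inside the Peirce space
    of [d], with eigenvalue [l_i]; applying [quad_quad] to [c_i] shows that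
    [l_i^2 c_i] is a multiple of [P(d)p].  Any [c_i] with [l_i] nonzero will do. *)
Lemma compress_prim d p : idem d -> prim p ->
  quad d p = 0 \/ exists a q, [/\ a != 0, prim q, d ** q = q & quad d p = a *: q].
Proof.
move=> idd pp; have d1 := quad_idem1 idd p.
have [r [lam [cs spec]]] := spectral_theorem idd d1.
have [[i li]|nz] := pselect (exists i, lam i != 0); [right|left]; last first.
  rewrite (spectral_sum spec) big1 // => i _; have [->|li] := eqVneq (lam i) 0.
    exact: scale0r.
  by case: nz; exists i.
have di := spectral_le spec i; have [l pl] := quad_prim (cs i) pp.
have lq : l *: quad d p = lam i ^+ 2 *: cs i.
  rewrite -quadZ -pl quad_quad // {1}/quad (spectral_sqr_op spec).
  rewrite (spectral_op spec) opZr (spectral_op spec) !scalerA -scalerBl.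
  by congr (_ *: _); ring.
have l0 : l != 0.
  apply: contra_neq li => l0; apply/eqP; rewrite -sqrf_eq0.
  move/eqP: lq; rewrite l0 scale0r eq_sym scaler_eq0 (negPf (spectral_neq0 spec i)).
  by rewrite orbF.
exists (l^-1 * lam i ^+ 2), (cs i); split => //.
- by rewrite mulf_neq0 ?invr_eq0 ?sqrf_eq0.
- exact: (spectral_primitive spec).
- by rewrite -scalerA -lq scalerA mulVf // scale1r.
Qed.

(** * Frames of an idempotent have the same size *)

(** For idempotents, orthogonality for the inner product and for the Jordan product
    agree; this and [dot_idem_orth] are the two directions. *)
Lemma idem_orth a b : idem a -> idem b -> dot a b = 0 -> b ** a = 0.
Proof. by move=> ida idb ab; rewrite -ida; apply: sqr_orth_idem; rewrite ?ida. Qed.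

(** Below [d], orthogonality to [p] can be tested on the compression of [p]. *)
Lemma compress_orth d p k : idem d -> idem p -> idem k -> d ** k = k ->
  dot (quad d p) k = 0 -> k ** p = 0.
Proof.
move=> idd idp idk dk; rewrite dot_quad // quad_id // => pk.
exact: idem_orth.
Qed.

Lemma dot_idem_orth a b : idem b -> b ** a = 0 -> dot a b = 0.
Proof. by move=> idb ba; rewrite -idb -(dotA b) ba dot0l. Qed.

(** The exchange property for a frame with two members [a, b].  Let
    [g = a + b - q].  Compressing [a] to [g] gives a multiple of some primitive [t]
    below [g], and [g - t] is an idempotent below [a + b] orthogonal to [a] and to
    [q]; it is thus below [b], so that it is 0 or [b], and [b] is excluded because
    it is not orthogonal to [q].  Hence [g = t].  If [a] compresses to 0, the same
    argument applied to [g] itself gives [g = 0], which is absurd. *)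
Lemma prim_rank2 a b q : prim a -> prim b -> a ** b = 0 -> prim q ->
  (a + b) ** q = q -> dot q b != 0 -> prim (a + b - q).
Proof.
move=> pa pb ab pq fq qb.
have [ida a0 _] := pa; have [idb b0 _] := pb; have [idq q0 nq] := pq.
have idf := idemD ida idb ab; set f := a + b in idf fq *.
have [idg gq] := idemB idf idq fq; set g := f - q in idg gq *.
have fg : f ** g = g by rewrite opDr opNr idf fq.
have g0 : g != 0.
  rewrite subr_eq0; apply/eqP => fqe; apply: nq; exists a, b.
  by split => //; rewrite -fqe.
(* Such a [k] is 0 or [b], and it is orthogonal to [q] while [b] is not. *)
have rest k : idem k -> f ** k = k -> g ** k = k -> k ** a = 0 -> k = 0.
  move=> idk fk gk ka; apply/eqP; apply: contraNT qb => k0.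
  have bk : b ** k = k by rewrite -{2}fk opDl (opC a) ka add0r.
  rewrite -(prim_le_eq pb idk k0 bk) (dot_idem_orth idk) //.
  exact: (peirce10 idg gk gq).
have [qa|[s [t [s0 pt gt qa]]]] := compress_prim idg pa.
  have ga : g ** a = 0 by apply: (compress_orth idg ida idg idg); rewrite qa dot0l.
  by rewrite (rest g idg fg idg ga) eqxx in g0.
have [idt _ _] := pt; have [idk kt] := idemB idg idt gt.
have gk : g ** (g - t) = g - t by rewrite opDr opNr idg gt.
have fk : f ** (g - t) = g - t by rewrite (idem_le_trans idg idf fg gk).
have ka : (g - t) ** a = 0.
  apply: (compress_orth idg ida idk gk).
  by rewrite qa dotZl (dot_idem_orth idk kt) mulr0.
by move/eqP: (rest _ idk fk gk ka); rewrite subr_eq0 => /eqP ->.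
Qed.

(** A new member only has to be orthogonal to the sum [d] of the previous ones:
    these are below [d], so it is then orthogonal to each of them. *)
Inductive frame : nat -> E -> Prop :=
| frame_nil : frame 0 0
| frame_cons n d p : frame n d -> prim p -> d ** p = 0 -> frame n.+1 (d + p).

Lemma frame_idem n d : frame n d -> idem d.
Proof.
elim=> [|m c p _ idc [idp _ _] cp]; first exact: op0l.
exact: idemD.
Qed.

Lemma frame0 d : frame 0 d -> d = 0.
Proof. by move nE: 0%N => n fd; case: fd nE. Qed.

Lemma frameS n d : frame n.+1 d -> exists c p,
  [/\ frame n c, prim p, c ** p = 0 & d = c + p].
Proof.
move mE: n.+1 => m fd; case: fd mE => // k c p fc pp cp [->].
by exists c, p.
Qed.

Lemma frameS_neq0 n d : frame n.+1 d -> d != 0.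
Proof.
move=> /frameS[c [p [fc [idp p0 _] cp ->]]]; apply: contra_neq p0 => cp0.
by rewrite -idp -[p ** p]add0r -cp -opDl cp0 op0l.
Qed.

(** Let [d = d1 + a], where [a] is the last member of the frame.  If [q] is
    orthogonal to [d1], then [q = a].  Otherwise [q] compresses to a multiple of
    some primitive [t] below [d1].  By induction [d1 - t] has a frame with one
    member fewer than that of [d1], and adding the primitive idempotent
    [a + t - q] of [prim_rank2] to it gives a frame of [d - q]. *)
Lemma frame_exchange n d q : frame n.+1 d -> prim q -> d ** q = q -> frame n (d - q).
Proof.
elim: n d q => [|n IHn] d q fd pq dq; have idd := frame_idem fd;
  have [d1 [a [fd1 pa d1a dE]]] := frameS fd; have idd1 := frame_idem fd1;
  have [ida a0 _] := pa; have [idq q0 _] := pq.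
  have d10 := frame0 fd1; rewrite d10 add0r in dE.
  have aq : a ** q = q by rewrite -dE.
  by rewrite (prim_le_eq pa idq q0 aq) dE subrr; apply: frame_nil.
have [d1q|[s [t [s0 pt d1t d1q]]]] := compress_prim idd1 pq.
  have d1q0 : d1 ** q = 0.
    by apply: (compress_orth idd1 idq idd1 idd1); rewrite d1q dot0l.
  have aq : a ** q = q by rewrite -{2}dq dE opDl d1q0 add0r.
  by rewrite (prim_le_eq pa idq q0 aq) dE addrK.
have [idt t0 _] := pt; have [idk kt] := idemB idd1 idt d1t.
have fk := IHn _ _ fd1 pt d1t.
have at0 : a ** t = 0 by rewrite opC (peirce10 idd1).
have d1k : d1 ** (d1 - t) = d1 - t by rewrite opDr opNr idd1 d1t.
have kq : (d1 - t) ** q = 0.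
  apply: (compress_orth idd1 idq idk d1k).
  by rewrite d1q dotZl (dot_idem_orth idk kt) mulr0.
have dE' : d = (d1 - t) + (a + t) by rewrite dE addrACA addNr addr0.
have fq : (a + t) ** q = q by rewrite -{2}dq dE' [RHS]opDl kq add0r.
have qt : dot q t != 0.
  have := dot_quad idd1 q t; rewrite (quad_id idd1 d1t) d1q dotZl => <-.
  by rewrite mulf_neq0 // gt_eqF // dot_gt0.
have pg := prim_rank2 pa pt at0 pq fq qt.
have -> : d - q = (d1 - t) + (a + t - q) by rewrite dE' [RHS]addrA.
apply: frame_cons => //; rewrite opDr opNr kq subr0 opDr kt addr0.
by rewrite opDl opNl d1a (opC t) at0 subr0.
Qed.

Lemma frame_unique n m d : frame n d -> frame m d -> n = m.
Proof.
elim: n m d => [|n IHn] [|m] d fn fm //.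
- by have := frameS_neq0 fm; rewrite (frame0 fn) eqxx.
- by have := frameS_neq0 fn; rewrite (frame0 fm) eqxx.
have [c [p [fc pp cp dE]]] := frameS fn; congr _.+1.
have dp : d ** p = p by have [idp _ _] := pp; rewrite dE opDl cp idp add0r.
by apply: (IHn _ c) => //; have := frame_exchange fm pp dp; rewrite dE addrK.
Qed.

Lemma frame_cat n m c d : frame n c -> frame m d -> c ** d = 0 ->
  frame (n + m) (c + d).
Proof.
move=> fc fd; elim: fd => [|k a p fa IH pp ap] cd; first by rewrite addn0 addr0.
have ida := frame_idem fa; have [idp _ _] := pp; have idap := idemD ida idp ap.
have ca : c ** a = 0.
  rewrite opC; apply: (peirce10 idap); last by rewrite opC.
  by rewrite opDl ida (opC p) ap addr0.
have cp : c ** p = 0 by move: cd; rewrite opDr ca add0r.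
by rewrite addnS addrA; apply: frame_cons; rewrite ?opDl ?cp ?ap ?addr0 //; apply: IH.
Qed.

Lemma frame_sum r (cs : 'I_r -> E) : (forall i, prim (cs i)) ->
  (forall i j, i != j -> cs i ** cs j = 0) -> frame r (\sum_i cs i).
Proof.
elim: r cs => [|r IHr] cs csp cso; first by rewrite big_ord0; apply: frame_nil.
rewrite big_ord_recr; apply: frame_cons => //.
  apply: IHr => // i j ij; apply: cso; apply: contra_neq ij => ijE.
  exact/val_inj/(congr1 val ijE).
rewrite op_suml big1 // => i _; apply: cso.
by rewrite neq_ltn /= ltn_ord.
Qed.

Lemma frame_exists c : idem c -> exists n, frame n c.
Proof.
move=> idc; have [r [lam [cs spec]]] := spectral_theorem idc idc.
exists r; rewrite -(spectral_complete spec).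
exact: frame_sum (spectral_primitive spec) (spectral_orthogonal spec).
Qed.

(** * Faces of the cone of squares *)

Section Cone.
Variables (K : set E) (e : E).
Hypotheses (squaresK : K = cone_of_squares op) (dualK : K = dual_cone dot K).
Hypothesis unit_e : jordan_unit op e.

Lemma unit_op x : e ** x = x. Proof. by case: (unit_e x). Qed.

Lemma cone_sqr z : K (z ** z). Proof. by rewrite squaresK; exists z. Qed.

Lemma cone_idem c : idem c -> K c.
Proof. by move=> idc; rewrite -idc; apply: cone_sqr. Qed.

Lemma cone_dot_ge0 x y : K x -> K y -> 0 <= dot x y.
Proof. by rewrite {1}dualK; apply. Qed.

Lemma coneD x y : K x -> K y -> K (x + y).
Proof.
move=> Kx Ky; rewrite dualK => z Kz.
by rewrite dotDl addr_ge0 ?cone_dot_ge0.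
Qed.

Lemma coneZ a x : 0 <= a -> K x -> K (a *: x).
Proof.
move=> a0 Kx; rewrite dualK => z Kz.
by rewrite dotZl mulr_ge0 ?cone_dot_ge0.
Qed.

Lemma cone0 : K 0. Proof. exact/cone_idem/op0l. Qed.

(** Immediate from [sqr_orth_idem], as the elements of the cone are squares. *)
Lemma cone_orth x c : K x -> idem c -> dot x c = 0 -> c ** x = 0.
Proof. by rewrite {1}squaresK => -[z _ <-] idc; apply: sqr_orth_idem. Qed.

Lemma cone_spectral c x : K x -> idem c -> c ** x = x ->
  exists r (lam : 'I_r -> R) (cs : 'I_r -> E),
    spectral_decomposition op c x lam cs /\ forall i, 0 <= lam i.
Proof.
move=> Kx idc cx; have [r [lam [cs spec]]] := spectral_theorem idc cx.
exists r, lam, cs; split=> // i; have idi := spectral_idem spec i.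
have := cone_dot_ge0 Kx (cone_idem idi); rewrite -{1}idi -(dotA (cs i)) opC.
by rewrite (spectral_op spec) dotZl pmulr_lge0 // dot_gt0 // (spectral_neq0 spec).
Qed.

Lemma cone_sum r (lam : 'I_r -> R) (cs : 'I_r -> E) (P : pred 'I_r) :
  (forall i, 0 <= lam i) -> (forall i, K (cs i)) -> K (\sum_(i | P i) lam i *: cs i).
Proof.
move=> lam0 Kcs; apply: big_ind; [exact: cone0|exact: coneD|move=> i _].
exact: coneZ.
Qed.

Section OneFace.
Variable F : set E.
Hypotheses (faceF : face K F) (F_nonempty : F !=set0).

Lemma face_sub x : F x -> K x. Proof. by case: faceF => FK _ _ /FK. Qed.

Lemma face_summand u v : K u -> K v -> F (2^-1 *: (u + v)) -> F u.
Proof.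
case: faceF => _ _ Fext Ku Kv Fuv.
have h : 1 - 2^-1 = 2^-1 :> R by field.
have h01 : 0 < (2^-1 : R) < 1 by apply/andP; split; lra.
by have [] := Fext u v 2^-1 Ku Kv h01; rewrite // h -scalerDr.
Qed.

Lemma half_double (x : E) : 2^-1 *: (2 *: x) = x.
Proof. by rewrite scalerA mulVf ?scale1r ?pnatr_eq0. Qed.

Lemma face_zero : F 0.
Proof.
case: F_nonempty => u Fu; apply: (@face_summand _ (2 *: u)).
- exact: cone0.
- by apply: coneZ => //; apply: face_sub.
- by rewrite add0r half_double.
Qed.

(** [x] lies on the open segment from 0 to [(a + 2)x], so this multiple is in the
    face; it is the midpoint of [a x] and [(a + 4)x]. *)
Lemma faceZ a x : 0 <= a -> F x -> F (a *: x).
Proof.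
move=> a0 Fx; have Kx := face_sub Fx.
have b1 : 0 < (1 + (a + 1))^-1 < 1.
  by rewrite invr_gt0 invf_lt1; try (apply/andP; split); lra.
have Fb : F ((1 + (a + 1)) *: x).
  case: faceF => _ _ /(_ ((1 + (a + 1)) *: x) 0 _ _ _ b1) [] //.
  - by apply: coneZ => //; lra.
  - exact: cone0.
  - rewrite scaler0 addr0 scalerA mulVf ?scale1r //; apply/eqP; lra.
apply: (@face_summand _ ((a + 4) *: x)); try by apply: coneZ => //; lra.
by rewrite -scalerDl scalerA (_ : _ * _ = 1 + (a + 1)) //; field.
Qed.

Lemma face_addl a b : K a -> K b -> F (a + b) -> F a.
Proof.
move=> Ka Kb Fab; rewrite -(half_double a); apply: faceZ; first by lra.
apply: (@face_summand _ (2 *: b)); try exact: coneZ.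
by rewrite -scalerDr half_double.
Qed.

Lemma faceD x y : F x -> F y -> F (x + y).
Proof.
move=> Fx Fy; case: faceF => _ convF _.
have h01 : 0 <= (2^-1 : R) by lra.
have h11 : (2^-1 : R) <= 1 by lra.
have : F (conv (Itv01 h01 h11) (x : convex_lmodType E) y).
  exact: set_mem (convF x y (Itv01 h01 h11) (mem_set Fx) (mem_set Fy)).
rewrite -[conv _ _ _]/(2^-1 *: x + (1 - 2^-1) *: y : E) => /(faceZ (ler0n _ 2)).
have -> : 1 - 2^-1 = 2^-1 :> R by field.
by rewrite -scalerDr scalerA mulfV ?scale1r ?pnatr_eq0.
Qed.

Lemma face_lincomb r (lam : 'I_r -> R) (cs : 'I_r -> E) (P : pred 'I_r) :
  (forall i, P i -> 0 <= lam i) -> (forall i, P i -> F (cs i)) ->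
  F (\sum_(i | P i) lam i *: cs i).
Proof.
move=> lam0 Fcs; apply: big_ind => [|u v Fu Fv|i Pi]; first exact: face_zero.
  exact: faceD.
by apply: faceZ; [exact: lam0|exact: Fcs].
Qed.

Lemma face_term r (lam : 'I_r -> R) (cs : 'I_r -> E) i :
  (forall i, 0 <= lam i) -> (forall i, K (cs i)) -> F (\sum_i lam i *: cs i) ->
  0 < lam i -> F (cs i).
Proof.
move=> lam0 Kcs; rewrite (bigD1 i) //= => /face_addl Fi lami.
have {}Fi : F (lam i *: cs i) by apply: Fi; [exact: coneZ|exact: cone_sum].
rewrite -[cs i]scale1r -(mulVf (lt0r_neq0 lami)) -scalerA.
by apply: faceZ => //; rewrite invr_ge0.
Qed.

(** The members of a frame of [g] are summands of [g], hence in the face, and [y]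
    is a combination of the members of some frame of [g]. *)
Lemma face_contains_peirce1 g y : idem g -> F g -> K y -> g ** y = y -> F y.
Proof.
move=> idg Fg Ky gy; have [r [lam [cs [spec lam0]]]] := cone_spectral Ky idg gy.
have Kcs i := cone_idem (spectral_idem spec i).
rewrite (spectral_sum spec); apply: face_lincomb => [//|i _].
apply: (@face_term r (fun=> 1)) => //.
under eq_bigr do rewrite scale1r.
by rewrite (spectral_complete spec).
Qed.

(** Take the sum of those members of a diagonalising frame of [s] that have a
    nonzero eigenvalue. *)
Lemma face_support s : F s -> exists h, [/\ idem h, F h & h ** s = s].
Proof.
move=> Fs; have Ks := face_sub Fs; have ide : idem e := unit_op e.
have [r [lam [cs [spec lam0]]]] := cone_spectral Ks ide (unit_op s).
have Kcs i := cone_idem (spectral_idem spec i).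
pose mu i : R := (lam i != 0)%:R; exists (\sum_i mu i *: cs i); split.
- rewrite /idempotent_elt op_sumr; apply: eq_bigr => i _.
  rewrite opZr (spectral_lincomb_op spec) scalerA /mu.
  by case: eqP; rewrite ?mulr1 ?mulr0.
- rewrite (bigID (fun i => lam i == 0)) /= big1 => [|i /eqP li]; last first.
    by rewrite /mu li eqxx scale0r.
  rewrite add0r; apply: face_lincomb => i li; first exact: ler0n.
  apply: (@face_term r lam) => //; first by rewrite -(spectral_sum spec).
  by rewrite lt_def li lam0.
- rewrite {1}(spectral_sum spec) op_sumr [RHS](spectral_sum spec).
  apply: eq_bigr => i _; rewrite opZr (spectral_lincomb_op spec) scalerA /mu.
  by case: eqP => [->|_]; rewrite ?mulr1 ?mul0r.
Qed.

(** Take [g] in the face with the largest Peirce 1-space.  For [x] in the face,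
    [e - h] is orthogonal to [g + x], where [h] is the support of [g + x], and so
    it is orthogonal to both terms, which have nonnegative inner products with it.
    Thus [g] is below [h], maximality gives [g = h], and [h] fixes [x]. *)
Lemma face_idempotent : exists g, [/\ idem g, F g & forall x, F x -> g ** x = x].
Proof.
pose P n := `[< exists g, [/\ idem g, F g & \dim (peirce1 g) = n] >].
have exP : exists n, P n.
  exists (\dim (peirce1 0)); apply/asboolP; exists 0.
  by split; [exact: op0l|exact: face_zero|].
have ubP n : P n -> (n <= \dim {:E})%N.
  by move=> /asboolP[g [_ _ <-]]; apply/dimvS/subvf.
case: (ex_maxnP exP ubP) => n /asboolP[g [idg Fg <-]] maxg; exists g; split=> // x Fx.
have Kx := face_sub Fx; have Kg := cone_idem idg.
have [h [idh Fh hs]] := face_support (faceD Fg Fx).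
have [ideh eh] := idemB (unit_op e : idem e) idh (unit_op h).
have [gh xh] : dot g (e - h) = 0 /\ dot x (e - h) = 0.
  have : dot (g + x) (e - h) = 0.
    by rewrite dot_idem_orth // opDl opNl unit_op hs subrr.
  have gg := cone_dot_ge0 Kg (cone_idem ideh).
  have xx := cone_dot_ge0 Kx (cone_idem ideh).
  by rewrite dotDl => s; split; lra.
have complement y : K y -> dot y (e - h) = 0 -> h ** y = y.
  move=> Ky /(cone_orth Ky ideh); rewrite opDl opNl unit_op => /eqP.
  by rewrite subr_eq0 => /eqP.
have hg := complement g Kg gh.
have [->|gneh] := eqVneq g h; first exact: complement.
have := dim_peirce1_lt idg idh hg gneh; rewrite ltnNge maxg //.
by apply/asboolP; exists h.
Qed.

End OneFace.

(** * Chains of faces *)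

Lemma frame_unit_bound n g : idem g -> frame n g ->
  exists2 m, frame m e & (n <= m)%N.
Proof.
move=> idg fn; have [idk kg] := idemB (unit_op e : idem e) idg (unit_op g).
have [m fm] := frame_exists idk; exists (n + m)%N; last exact: leq_addr.
rewrite -[e](subrK g) [_ - g + g]addrC.
by apply: frame_cat => //; rewrite opC.
Qed.

(** Climbing the chain from its smallest face, the idempotents attached to the
    faces gain at least one primitive summand at each step: if two of them were
    equal, [face_contains_peirce1] would make the larger face part of the smaller
    one. *)
Lemma face_chain_frame l F : face_chain K l.+1 F -> forall i, (i <= l)%N ->
  exists n g, [/\ (i <= n)%N, frame n g, F (l - i)%N g &
                  forall x, F (l - i)%N x -> g ** x = x].
Proof.
move=> [Fface Fprop]; elim=> [|i IHi] il.
  have [|fF neF] := Fface (l - 0)%N; first by rewrite subn0.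
  have [g [idg Fg gP]] := face_idempotent fF neF.
  by have [n fn] := frame_exists idg; exists n, g.
have [n [g [ni fg Fg gP]]] := IHi (ltnW il).
have [fF neF] := Fface (l - i.+1)%N (leq_ltn_trans (leq_subr _ _) (ltnSn _)).
have [h [idh Fh hP]] := face_idempotent fF neF.
have [sFF nsFF] : F (l - i)%N `<` F (l - i.+1)%N.
  have := Fprop (l - i.+1)%N; rewrite -subSn // subSS; apply.
  by rewrite ltnS leq_subr.
have [fF' neF'] := Fface (l - i)%N (leq_ltn_trans (leq_subr _ _) (ltnSn _)).
have hg := hP _ (sFF _ Fg); have idg := frame_idem fg.
have [idk kg] := idemB idh idg hg.
have [m fm] := frame_exists idk; exists (n + m)%N, h; split => //; last first.
  by rewrite -[h](subrK g) [_ - g + g]addrC; apply: frame_cat => //; rewrite opC.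
case: m fm => [|m] fm; last by rewrite addnS ltnS (leq_trans ni) ?leq_addr.
have := frame0 fm => /eqP; rewrite subr_eq0 => /eqP hgE; case: nsFF => x Fx.
apply: (face_contains_peirce1 fF' neF' idg Fg); first exact: (face_sub fF).
by rewrite -hgE hP.
Qed.

Lemma face_chain_bound r l F : frame r e -> face_chain K l F -> (l <= r.+1)%N.
Proof.
case: l => // l fr chF; have [n [g [ln fg _ _]]] := face_chain_frame chF (leqnn l).
have [m fm nm] := frame_unit_bound (frame_idem fg) fg.
by rewrite (frame_unique fr fm) ltnS (leq_trans ln).
Qed.

Lemma exposed_face f : K f -> face K [set y | K y /\ dot y f = 0].
Proof.
move=> Kf; split.
- by move=> y [].
- move=> x y t /set_mem[Kx xf] /set_mem[Ky yf]; apply: mem_set.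
  rewrite -[conv _ _ _]/(t%:num *: x + (1 - t%:num) *: y : E).
  split; last by rewrite dotDl !dotZl xf yf !mulr0 addr0.
  by apply: coneD; apply: coneZ => //; rewrite subr_ge0.
- move=> u v a Ku Kv /andP[a0 a1] [_]; rewrite dotDl !dotZl => uv.
  have uf := cone_dot_ge0 Ku Kf; have vf := cone_dot_ge0 Kv Kf.
  have a1' : 0 < 1 - a by rewrite subr_gt0.
  move/eqP: uv; rewrite paddr_eq0 ?mulr_ge0 // ?ltW //.
  by rewrite !mulf_eq0 (gt_eqF a0) (gt_eqF a1') => /andP[/eqP ? /eqP ?].
Qed.

(** The partial sums [f k] of the frame expose these faces; the idempotent [cs k]
    is orthogonal to [f k] but not to [f k.+1]. *)
Lemma face_chain_exists r (lam : 'I_r -> R) (cs : 'I_r -> E) x :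
  spectral_decomposition op e x lam cs -> exists F, face_chain K r.+1 F.
Proof.
move=> spec; have idi := spectral_idem spec; have Kcs i := cone_idem (idi i).
pose f k := \sum_(i < r | (i < k)%N) cs i.
have Kf k : K (f k) by apply: big_ind => //; [exact: cone0|exact: coneD].
exists (fun k => [set y | K y /\ dot y (f k) = 0]); split.
  move=> i _; split; first exact: exposed_face.
  by exists 0; split; [exact: cone0|rewrite dot0l].
move=> k; rewrite ltnS => kr; pose i0 := Ordinal kr.
have fS : f k.+1 = cs i0 + f k.
  rewrite /f (bigD1 i0) ?ltnSn //=; congr (_ + _); apply: eq_bigl => i.
  by rewrite ltnS leq_eqVlt -val_eqE /=; case: ltngtP.
split=> [y [Ky]|sub].
  rewrite fS dotDr => s; split => //.
  have := cone_dot_ge0 Ky (Kcs i0); have := cone_dot_ge0 Ky (Kf k); lra.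
have [_] : K (cs i0) /\ dot (cs i0) (f k.+1) = 0.
  apply: sub; split => //; rewrite dotC dot_suml big1 // => i ik.
  apply: dot_idem_orth => //; apply: (spectral_orthogonal spec).
  by rewrite -val_eqE /= gtn_eqF.
rewrite fS dotDr => s.
have := cone_dot_ge0 (Kcs i0) (Kf k); have := dot_gt0 (spectral_neq0 spec i0).
lra.
Qed.

Lemma nat_max_eq (A : set nat) m : A m -> ubound A m -> nat_max A = m.
Proof.
move=> Am ubm; apply: xget_unique => [//|n [An ubn]].
by apply/eqP; rewrite eqn_leq; apply/andP; split; [apply: ubm|apply: ubn].
Qed.

Lemma spectral_frame x r (lam : 'I_r -> R) (cs : 'I_r -> E) :
  spectral_decomposition op e x lam cs -> frame r e.
Proof.
move=> spec; rewrite -(spectral_complete spec).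
exact: frame_sum (spectral_primitive spec) (spectral_orthogonal spec).
Qed.

(** [jordan_rank] is a chosen value; that it comes from some decomposition is
    enough to compare it with the size of a frame. *)
Lemma jordan_rankP x : exists r (lam : 'I_r -> R) (cs : 'I_r -> E),
  spectral_decomposition op e x lam cs /\ jordan_rank op e x = #|[pred i | lam i != 0]|.
Proof.
have [r [lam [cs spec]]] := spectral_theorem (unit_op e : idem e) (unit_op x).
by apply: (@xgetPex _ 0%N [set k | exists r (lam : 'I_r -> R) (c : 'I_r -> E),
    spectral_decomposition op e x lam c /\ k = #|[pred i | lam i != 0]|]);
  exists #|[pred i | lam i != 0]|, r, lam, cs.
Qed.

Lemma cone_rank_frame r : frame r e -> cone_rank op e K = r.
Proof.
move=> fr; apply: nat_max_eq => [|k [x _ <-]].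
  exists e; first exact: cone_idem (unit_op e).
  have [n [lam [cs [spec ->]]]] := jordan_rankP e.
  rewrite (frame_unique fr (spectral_frame spec)) -[RHS]card_ord.
  apply: eq_card => i; rewrite !inE.
  have := spectral_op spec i; rewrite unit_op => /eqP; apply: contraTneq => ->.
  by rewrite scale0r (spectral_neq0 spec).
have [n [lam [cs [spec ->]]]] := jordan_rankP x.
rewrite -(frame_unique (spectral_frame spec) fr).
by have := max_card [pred i | lam i != 0]; rewrite card_ord.
Qed.

Lemma longest_face_chain_rank : longest_face_chain K = (cone_rank op e K + 1)%N.
Proof.
have [r [lam [cs spec]]] := spectral_theorem (unit_op e : idem e) (unit_op e).
have fr := spectral_frame spec; rewrite (cone_rank_frame fr) addn1.
apply: nat_max_eq; first exact: face_chain_exists spec.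
by move=> l [F chF]; apply: face_chain_bound chF.
Qed.

End Cone.
End EuclideanJordan.

Theorem theorem20 (R : realType) (E : vectType R) (dot : {dot E for idfun}%R)
    (K : set E) (op : {bilinear E -> E -> E}%R) (e : E)
    (symmK : symmetric_cone dot K)
    (eja : euclidean_jordan_algebra op dot)
    (unit_e : jordan_unit op e)
    (squaresK : K = cone_of_squares op) :
  longest_face_chain K = (cone_rank op e K + 1)%N.
Proof.
exact (longest_face_chain_rank eja squaresK (symmetric_cone_selfdual symmK) unit_e).
Qed.
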